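(* Let $x:\Sigma\to\mathbb{R}^{3}$ be an umbilic-free $\Omega$-surface with Gauss map $n$, and let $x^{D},\hat{x}:\Sigma\to\mathbb{R}^{3}$ be an associate surface and corresponding associate Gauss map of $x$. Then $\{x,x^{D},\hat{x},n\}$ is a system of $O$-surfaces, with constant symmetric matrix $$S=\begin{pmatrix}0&1&0&0\\1&0&0&0\\0&0&0&1\\0&0&1&0\end{pmatrix},$$ where $n$ is considered as a surface oriented so that its principal curvatures are both $-1$.
   Context: All objects are smooth and the statement is local. $\Sigma$ is a 2-manifold. Maps $x^{1},\dots,x^{k}:\Sigma\to\mathbb{R}^{3}$ are Combescure transformations of each other if their curvature directions are pairwise parallel; they then induce common curvature subbundles $T_{1},T_{2}\le T\Sigma$. Let $\kappa_{j}^{i}$ be the principal curvature of $x^{i}$ along $T_{j}$ and $K_{j}=(1/\kappa_{j}^{1},\dots,1/\kappa_{j}^{k})$. $\{x^{1},\dots,x^{k}\}$ is a system of $O$-surfaces if there is a constant symmetric $k\times k$ matrix $S$ with $K_{1}SK_{2}^{t}=0$. Conventions: $x$ has Gauss map $n$ and non-zero principal curvatures $\kappa_{1},\kappa_{2}$ with $dn|_{T_{j}}+\kappa_{j}\,dx|_{T_{j}}=0$. The surfaces $x^{D}$ and $\hat{x}$ are oriented to have Gauss map $-n$, so that their principal curvatures $\kappa_{j}^{D},\hat{\kappa}_{j}$ satisfy $dx^{D}|_{T_{j}}=\frac{1}{\kappa_{j}^{D}}dn|_{T_{j}}$ and $d\hat{x}|_{T_{j}}=\frac{1}{\hat{\kappa}_{j}}dn|_{T_{j}}$;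 only the reciprocals $1/\kappa_{j}^{D}$, $1/\hat{\kappa}_{j}$ are needed, and these may vanish. $\mathbb{R}^{4,2}$ is a six-dimensional real vector space with a symmetric bilinear form $(\cdot,\cdot)$ of signature $(4,2)$; $(a\wedge b)c=(a,c)b-(b,c)a$ identifies $\wedge^{2}\mathbb{R}^{4,2}$ with $\mathfrak{o}(4,2)$. Choose $\mathfrak{p},\mathfrak{q}_{\infty},\mathfrak{q}_{0}\in\mathbb{R}^{4,2}$ with $|\mathfrak{p}|^{2}=-1$, $\mathfrak{q}_{\infty},\mathfrak{q}_{0}$ null and orthogonal to $\mathfrak{p}$, $(\mathfrak{q}_{0},\mathfrak{q}_{\infty})=-1$, and identify $\mathbb{R}^{3}=\langle\mathfrak{q}_{\infty},\mathfrak{p},\mathfrak{q}_{0}\rangle^{\perp}$. Set $\mathfrak{f}=x+\mathfrak{q}_{0}+\frac12(x,x)\mathfrak{q}_{\infty}$, $\mathfrak{t}=n+(n,x)\mathfrak{q}_{\infty}+\mathfrak{p}$, $f=\langle\mathfrak{f},\mathfrak{t}\rangle$ (a rank 2 null subbundle of $\Sigma\times\mathbb{R}^{4,2}$). $x$ is an $\Omega$-surface if there is a closed 1-form $\eta$ with values in $f\wedge f^{\perp}$ with $[\eta\wedge\eta]=0$ such that the 2-tensor $q(X,Y)=\mathrm{tr}(f\to f,\ \sigma\mapsto\eta(X)d_{Y}\sigma)$ is non-degenerate on a dense open subset of $\Sigma$. Associate surfaces: after replacing $\eta$ by $\eta-d\tau$ for a suitable section $\tau$ of $\wedge^{2}f$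 one may assume that $(\eta\mathfrak{p},\mathfrak{q}_{\infty})=0$; then $\eta=\mathfrak{f}\wedge d\mathfrak{f}\circ A+\mathfrak{t}\wedge d\mathfrak{t}\circ B$ with $A,B\in\Gamma\mathrm{End}(T\Sigma)$ preserving $T_{1}$ and $T_{2}$, and $dx\circ A$, $dn\circ B$ are closed. An associate surface $x^{D}$ and the corresponding associate Gauss map $\hat{x}$ are maps with $dx^{D}=dx\circ A$ and $d\hat{x}=dn\circ B$. *)

(* Defs.v *)
From HB Require Import structures.
From mathcomp Require Import all_boot all_order all_algebra.
From mathcomp Require Import all_classical all_reals all_analysis.
Set Implicit Arguments.
Unset Strict Implicit.
Unset Printing Implicit Defensive.
Import Order.TTheory GRing.Theory Num.Theory.
Import numFieldNormedType.Exports.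
Local Open Scope classical_set_scope.
Local Open Scope ring_scope.

(* The surface Sigma is a coordinate domain: an open set U of R^2.  Points,
   tangent vectors and vectors of R^3 and R^{4,2} are row vectors, and an
   endomorphism M acts on the right, v |-> v *m M.  In particular the composite
   "M after N" is the matrix N *m M. *)

Section Smooth.
Variables (R : realType) (W : normedModType R).
Implicit Type U : set 'rV[R]_2.

Fixpoint Ck_on U (k : nat) (g : 'rV[R]_2 -> W) : Prop :=
  match k with
  | 0 => forall u, U u -> {for u, continuous g}
  | k'.+1 => (forall u, U u -> differentiable g u) /\
             (forall X, Ck_on U k' (fun u => 'd g u X))
  end.

Definition smooth U (g : 'rV[R]_2 -> W) : Prop := forall k, Ck_on U k g.

Definition smooth_form U (eta : 'rV[R]_2 -> {linear 'rV[R]_2 -> W}) : Prop :=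
  forall X, smooth U (fun u => eta u X).

(* d eta (X, Y) on constant (hence commuting) vector fields X, Y. *)
Definition ext_deriv (eta : 'rV[R]_2 -> 'rV[R]_2 -> W) (u X Y : 'rV[R]_2) : W :=
  'd (fun v => eta v Y) u X - 'd (fun v => eta v X) u Y.

Definition closed_form U (eta : 'rV[R]_2 -> 'rV[R]_2 -> W) : Prop :=
  forall u, U u -> forall X Y, ext_deriv eta u X Y = 0.

End Smooth.

Section Surfaces.
Variable R : realType.
Local Notation pt := 'rV[R]_2.
Local Notation E3 := 'rV[R]_3.
Implicit Types (U : set pt) (x n y N : pt -> E3) (T : 'I_2 -> pt -> set pt).

Definition dot (v w : E3) : R := (v *m w^T) 0 0.

Definition immersion U x : Prop :=
  smooth U x /\ forall u, U u -> forall X, 'd x u X = 0 -> X = 0.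

(* y need not be an immersion: N is a unit normal field along y. *)
Definition gauss_map U y N : Prop :=
  smooth U N /\
  forall u, U u -> dot (N u) (N u) = 1 /\ forall X, dot (N u) ('d y u X) = 0.

Definition line_subbundle U (L : pt -> set pt) : Prop :=
  forall u, U u -> exists (V : set pt) (e : pt -> pt),
    [/\ open V, V u, V `<=` U, smooth V e &
        forall v, V v -> e v != 0 /\ L v = [set X | exists c : R, X = c *: e v]].

Definition splitting U T : Prop :=
  (forall j, line_subbundle U (T j)) /\
  (forall u, U u -> T 0 u `&` T 1 u = [set 0]).

Definition curvature_subbundles U x n T (kappa : 'I_2 -> pt -> R) : Prop :=
  splitting U T /\
  forall j, smooth U (kappa j : pt -> R^o) /\
    forall u, U u -> forall X, T j u X -> 'd n u X + kappa j u *: 'd x u X = 0.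

Definition umbilic_free U (kappa : 'I_2 -> pt -> R) : Prop :=
  forall u, U u -> kappa 0 u != kappa 1 u.

(* r is the reciprocal of the principal curvature along the line L, for y with
   Gauss map N; it may vanish, and dN <> 0 on L makes it unique. *)
Definition recip_curvature y N (L : set pt) (u : pt) (r : R) : Prop :=
  forall X, L X -> X != 0 -> 'd N u X != 0 /\ 'd y u X + r *: 'd N u X = 0.

Definition parallel (v w : E3) : Prop := (\rank (col_mx v w) <= 1)%N.

Definition combescure U T k (y : 'I_k -> pt -> E3) : Prop :=
  forall i l j u, U u -> forall X, T j u X -> parallel ('d (y i) u X) ('d (y l) u X).

(* The surfaces y i, oriented by the Gauss maps N i and with common curvature
   subbundles T, form a system of O-surfaces with matrix S; K j is the row of
   reciprocals of their principal curvatures along T j. *)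
Definition O_system U T k (y N : 'I_k -> pt -> E3) (K : 'I_2 -> pt -> 'rV[R]_k)
    (S : 'M[R]_k) : Prop :=
  [/\ S^T = S,
      (forall i, smooth U (y i) /\ gauss_map U (y i) (N i)),
      splitting U T /\ combescure U T y,
      (forall i j u, U u -> recip_curvature (y i) (N i) (T j u) u (K j u 0 i)) &
      forall u, U u -> K 0 u *m S *m (K 1 u)^T = 0].

Definition row4 (a b c d : R) : 'rV[R]_4 := \row_(i < 4) [:: a; b; c; d]`_i.

Definition S_matrix : 'M[R]_4 :=
  \matrix_(i < 4, j < 4) (nth [::] [:: [:: 0; 1; 0; 0];
                                       [:: 1; 0; 0; 0];
                                       [:: 0; 0; 0; 1];
                                       [:: 0; 0; 1; 0]] i)`_j.

End Surfaces.

Section LieSphere.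
Variable R : realType.
Local Notation pt := 'rV[R]_2.
Local Notation E3 := 'rV[R]_3.
Local Notation V6 := 'rV[R]_6.

(* R^{4,2} is R^6 with an arbitrary Gram matrix G of signature (4,2). *)
Definition signature42 (G : 'M[R]_6) : Prop :=
  G^T = G /\
  exists2 P : 'M[R]_6, P \in unitmx &
    P *m G *m P^T = diag_mx (\row_(i < 6) (if (i < 4)%N then 1 else -1)).

Variable G : 'M[R]_6.

Definition form (a b : V6) : R := (a *m G *m b^T) 0 0.

(* The endomorphism c |-> (a,c) b - (b,c) a. *)
Definition wedge (a b : V6) : 'M[R]_6 := G *m a^T *m b - G *m b^T *m a.

Definition wedge_span (P Q : set V6) : set 'M[R]_6 :=
  [set M | exists2 s : seq (V6 * V6),
     (forall ab, ab \in s -> P ab.1 /\ Q ab.2) &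
     M = \sum_(ab <- s) wedge ab.1 ab.2].

Definition lie_bracket (M N : 'M[R]_6) : 'M[R]_6 := N *m M - M *m N.

Definition bracket_wedge (eta : pt -> pt -> 'M[R]_6) (u X Y : pt) : 'M[R]_6 :=
  lie_bracket (eta u X) (eta u Y) - lie_bracket (eta u Y) (eta u X).

(* iota identifies R^3 isometrically with <qinf, p, q0>^perp. *)
Definition frame (p qinf q0 : V6) (iota : {linear E3 -> V6}) : Prop :=
  [/\ form p p = -1,
      form qinf qinf = 0 /\ form q0 q0 = 0,
      form qinf p = 0 /\ form q0 p = 0,
      form q0 qinf = -1 &
      (forall v w, form (iota v) (iota w) = dot v w) /\
      (forall c, (exists v, c = iota v) <->
                 [/\ form c qinf = 0, form c p = 0 & form c q0 = 0])].

Variables (p qinf q0 : V6) (iota : {linear E3 -> V6}).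
Variables (U : set pt) (x n : pt -> E3).

Definition lift_f (u : pt) : V6 :=
  iota (x u) + q0 + (2^-1 * dot (x u) (x u)) *: qinf.

Definition lift_t (u : pt) : V6 :=
  iota (n u) + dot (n u) (x u) *: qinf + p.

(* The rows of [frame_f u] span the fibre of f at u. *)
Definition frame_f (u : pt) : 'M[R]_(1 + 1, 6) := col_mx (lift_f u) (lift_t u).

Definition fiber (u : pt) : set V6 := [set a | (a <= frame_f u)%MS].

Definition fiber_perp (u : pt) : set V6 :=
  [set b | forall a, fiber u a -> form a b = 0].

(* q(X,Y) is the trace of f -> f, sigma |-> eta(X) d_Y sigma: the rows of
   [col_mx ..] *m eta u X are the images of the frame of f, and right
   multiplication by pinvmx (frame_f u) takes their coordinates in that frame. *)
Definition q_tensor (eta : pt -> pt -> 'M[R]_6) (u X Y : pt) : R :=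
  \tr (col_mx ('d lift_f u Y) ('d lift_t u Y) *m eta u X *m pinvmx (frame_f u)).

Definition nondegenerate (b : pt -> pt -> R) : Prop :=
  forall X, (forall Y, b X Y = 0) -> X = 0.

Definition Omega_form (eta : pt -> {linear pt -> 'M[R]_6}) : Prop :=
  [/\ smooth_form U eta /\ closed_form U eta,
      (forall u, U u -> forall X,
         wedge_span (fiber u) (fiber_perp u) (eta u X)),
      (forall u, U u -> forall X Y, bracket_wedge eta u X Y = 0) &
      exists D : set pt, [/\ open D, D `<=` U, U `<=` closure D &
        forall u, D u -> nondegenerate (q_tensor eta u)]].

Definition Omega_surface : Prop := exists eta, Omega_form eta.

(* xD is an associate surface and xh the corresponding associate Gauss map: A
   and B are the endomorphism fields of the gauged form eta - d tau.  That they
   preserve the curvature subbundles, and that dx o A and dn o B are closed,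
   are consequences and not imposed. *)
Definition associate (xD xh : pt -> E3) : Prop :=
  exists (eta : pt -> {linear pt -> 'M[R]_6}) (tau : pt -> 'M[R]_6)
         (A B : pt -> 'M[R]_2),
  let eta' := fun u X => eta u X - 'd tau u X in
  [/\ Omega_form eta,
      smooth U tau /\
        (forall u, U u -> wedge_span (fiber u) (fiber u) (tau u)),
      (forall u, U u -> forall X, form (p *m eta' u X) qinf = 0),
      [/\ smooth U A, smooth U B &
          forall u, U u -> forall X,
            eta' u X = wedge (lift_f u) ('d lift_f u (X *m A u)) +
                       wedge (lift_t u) ('d lift_t u (X *m B u))] &
      [/\ smooth U xD, smooth U xh &
          forall u, U u -> forall X,
            'd xD u X = 'd x u (X *m A u) /\ 'd xh u X = 'd n u (X *m B u)]].

End LieSphere.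

(* Main.v *)
Require Import Defs.
From HB Require Import structures.
From mathcomp Require Import all_boot all_order all_algebra.
From mathcomp Require Import all_classical all_reals all_analysis.
From mathcomp Require Import ring lra.
Import Order.TTheory GRing.Theory Num.Theory.
Import numFieldNormedType.Exports.
Local Open Scope classical_set_scope.
Local Open Scope ring_scope.
Set Implicit Arguments.
Unset Strict Implicit.
Unset Printing Implicit Defensive.
Local Notation form := Defs.form.

(** The O-surface condition for {x, xD, xh, n} is the equation
      a_0 + a_1 + kappa_0 kappa_1 (b_0 + b_1) = 0
    between the eigenvalues a_j, b_j of A and B along the curvature directions,
    since 1/kappa^D_j = - a_j / kappa_j and 1/kappa^h_j = b_j.  Both this equation
    and the fact that A and B preserve the curvature directions come from closedness
    of the gauged form eta' = f /\ df.A + t /\ dt.B, which is closed because eta is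
    and because d (d tau) = 0 ([second_derivative_symmetric], [curl_free_diff]).

    Contracting eta' with the constant vectors qinf and p shows that df.A and dt.B
    are themselves closed.  Each is orthogonal to f and to t; differentiating these
    four orthogonality relations ([curl_free_orthogonal]) shows that
      (dx.A X, dx Y), (dx.A X, dn Y), (dn.B X, dx Y), (dn.B X, dn Y)
    are symmetric in X and Y ([associate_symmetries]).  The curvature directions are
    orthogonal, and dn scales them by distinct non-zero factors, so a pair of such
    symmetries makes A, respectively B, diagonal
    ([preserves_curvature_directions]).  What is left of d eta' = 0 is
    df /\ df.A + dt /\ dt.B = 0 ([curl_free_wedge]); its component along the two
    orthogonal tangent directions is the required equation ([principal_relation]). *)

(** * Symmetry of second derivatives *)

Section Schwarz.
Variables (R : realType) (V : normedModType R).
Implicit Types (g : V -> R) (u X Y : V).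

Lemma diff_error g u (e : R) : 0 < e -> differentiable g u ->
  \forall w \near (0 : V), `|g (u + w) - g u - 'd g u w| <= e * `|w|.
Proof.
move=> e0 dg.
have /eqaddoP/(_ _ e0) := diff_locally dg.
apply: filterS => w; rewrite /= !fctE /= [w + u]addrC.
by rewrite (_ : _ - (g u + _) = g (u + w) - g u - 'd g u w)// opprD addrA.
Qed.

Lemma is_derive_line g u X c (s d : R) :
  is_derive (u + (s *: X + c)) X g d ->
  is_derive s 1 (fun s => g (u + (s *: X + c))) d.
Proof.
set q := u + _ => -[dgX <-].
have E : (fun h : R => h^-1 *: (g (u + ((h *: (1 : R^o) + s) *: X + c)) - g q))
       = (fun h : R => h^-1 *: (g (h *: X + q) - g q)).
  apply/funext => h; rewrite /q [h *: (1 : R^o)]mulr1 scalerDl.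
  by rewrite -[h *: X + _ + c]addrA [u + (h *: X + _)]addrCA.
by apply: DeriveDef; rewrite /derivable /derive E//; exact: dgX.
Qed.

(** The increment of s |-> g (u + s X + h Y) - g (u + s X) over [0, h] equals, by
    the mean value theorem, h times a difference of values of gX at two points at
    distance O(h) from u; differentiability of gX at u turns that difference into
    h 'd gX u Y + o(h). *)
Lemma second_difference g gX u X Y (e : R) : 0 < e ->
  (\forall v \near u, is_derive v X g (gX v)) -> differentiable gX u ->
  \forall h \near (0 : R)^'+,
    `|g (u + h *: X + h *: Y) - g (u + h *: X) - g (u + h *: Y) + g u
      - h ^+ 2 * 'd gX u Y| <= e * h ^+ 2.
Proof.
move=> e0 dg dX.
(* C bounds |w1 s| + |w0 s| by h C and keeps both points in the ball where the
   expansion of gX is valid. *)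
pose C := 2 * `|X| + `|Y| + 1.
have C0 : 0 < C by rewrite ltr_wpDl// addr_ge0// mulr_ge0.
have eC0 : 0 < e / C by rewrite divr_gt0.
have Herr := diff_error eC0 dX.
pose L := 'd gX u; rewrite -/L in Herr *.
have Hs : (fun w => u + w) w @[w --> (0 : V)] --> u.
  by rewrite -[X in _ --> X]addr0; apply: cvgD; [exact: cvg_cst|exact: cvg_id].
have [r /= r0 Hr] := (nbhs_ballP (0 : V) _).1 (filterI Herr (Hs _ dg)).
near=> h.
have h0 : 0 < h by [].
have hr : h * C < r.
  rewrite -ltr_pdivlMr//; near: h; apply: nbhs_right_lt; exact: divr_gt0.
pose w1 s := s *: X + h *: Y.
pose w0 s := s *: X + (0 : V).
have Hw1 s : s \in `[0, h] -> `|w1 s| <= h * (`|X| + `|Y|).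
  rewrite in_itv/= => /andP[s0 sh].
  rewrite (le_trans (ler_normD _ _))// !normrZ (gtr0_norm h0) (ger0_norm s0).
  by rewrite mulrDr lerD2r ler_wpM2r.
have Hw0 s : s \in `[0, h] -> `|w0 s| <= h * `|X|.
  rewrite in_itv/= => /andP[s0 sh].
  by rewrite /w0 addr0 normrZ (ger0_norm s0) ler_wpM2r.
have Hb (w : V) : `|w| <= h * (`|X| + `|Y|) -> ball 0 r w.
  move=> Hw; rewrite -ball_normE /ball_/= sub0r normrN.
  apply: le_lt_trans hr; apply: le_trans Hw _; rewrite ler_wpM2l ?ltW//.
  by rewrite /C; have := normr_ge0 X; lra.
have b1 s : s \in `[0, h] -> ball 0 r (w1 s) by move=> /Hw1/Hb.
have b0 s : s \in `[0, h] -> ball 0 r (w0 s).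
  move=> /Hw0 H; apply: Hb; apply: le_trans H _.
  by rewrite ler_wpM2l ?lerDl// ltW.
pose phi s := g (u + w1 s) - g (u + w0 s).
pose dphi s := gX (u + w1 s) - gX (u + w0 s).
have dphiP s : s \in `[0, h] -> is_derive s 1 phi (dphi s).
  move=> sI; have [_ d1] := Hr _ (b1 _ sI); have [_ d0] := Hr _ (b0 _ sI).
  by apply: is_deriveB; exact: is_derive_line.
have dphi_in s : s \in `]0, h[ -> is_derive s 1 phi (dphi s).
  rewrite in_itv/= => /andP[/ltW s0 /ltW sh].
  by apply: dphiP; rewrite in_itv/= s0.
have cphi : {within `[0, h], continuous phi}.
  apply: derivable_within_continuous => s sh.
  by have [] := dphiP _ sh.
have [c ch Hc] := MVT_segment (ltW h0) dphi_in cphi.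
have [E1 _] := Hr _ (b1 _ ch); have [E0 _] := Hr _ (b0 _ ch).
have -> : g (u + h *: X + h *: Y) - g (u + h *: X) - g (u + h *: Y) + g u
   = phi h - phi 0.
  by rewrite /phi /w1 /w0 !scale0r !add0r !addr0 !addrA; ring.
rewrite Hc subr0 /dphi.
have -> : h ^+ 2 * L Y = (L (w1 c) - L (w0 c)) * h.
  by rewrite /w1 /w0 addr0 -linearB addrAC subrr add0r linearZ /=
    -[h *: _]/(h * _) expr2 -mulrA mulrC.
rewrite -mulrBl normrM (gtr0_norm h0) expr2 mulrA ler_pM2r//.
have : e / C * `|w1 c| + e / C * `|w0 c| <= e * h.
  rewrite -mulrDr -mulrA ler_pM2l// mulrC ler_pdivrMr//.
  apply: le_trans (lerD (Hw1 _ ch) (Hw0 _ ch)) _.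
  rewrite -mulrDr ler_pM2l// /C; lra.
apply: le_trans.
apply: le_trans (lerD E1 E0).
rewrite -[X in _ <= _ + X]normrN; apply: le_trans (ler_normD _ _).
by rewrite le_eqVlt; apply/orP; left; apply/eqP; congr `|_|; ring.
Unshelve. all: by end_near. Qed.

(** Young's form of Schwarz's theorem: the second difference is symmetric in X
    and Y, and after division by h^2 it tends to either side. *)
Lemma second_derivative_symmetric g gX gY u X Y :
  (\forall v \near u, is_derive v X g (gX v)) -> differentiable gX u ->
  (\forall v \near u, is_derive v Y g (gY v)) -> differentiable gY u ->
  'd gX u Y = 'd gY u X.
Proof.
move=> dgX dX dgY dY; apply/eqP; rewrite -subr_eq0 -normr_le0.
apply/ler_addgt0Pr => e e0; rewrite add0r.
have e20 : 0 < e / 2 by rewrite divr_gt0.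
near (0 : R)^'+ => h.
have h0 : 0 < h by [].
have HX : `|g (u + h *: X + h *: Y) - g (u + h *: X) - g (u + h *: Y) + g u
      - h ^+ 2 * 'd gX u Y| <= e / 2 * h ^+ 2.
  by near: h; exact: second_difference.
have HY : `|g (u + h *: Y + h *: X) - g (u + h *: Y) - g (u + h *: X) + g u
      - h ^+ 2 * 'd gY u X| <= e / 2 * h ^+ 2.
  by near: h; exact: second_difference.
have h2 : 0 < h ^+ 2 by rewrite exprn_gt0.
rewrite -(ler_pM2r h2) -[X in _ * X <= _](gtr0_norm h2) -normrM.
(* Both estimates are about the same second difference. *)
move: HX HY; rewrite [u + h *: Y + _]addrAC.
move: (g _) (g _) (g _) (g _) ('d gX u Y) ('d gY u X) => a b c d k l.
set m := h ^+ 2; rewrite !ler_norml; lra.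
Unshelve. all: by end_near. Qed.

End Schwarz.

(** * Product rules for matrix-valued maps *)

Section MatrixCalculus.
Variables (R : realType) (V : normedModType R).
Implicit Types (u X : V).

Lemma is_derive_mxP m n (M : V -> 'M[R]_(m, n)) u X (dM : 'M[R]_(m, n)) :
  is_derive u X M dM <->
  forall i j, is_derive u X (fun v => M v i j) (dM i j).
Proof.
split=> [[/[dup] dM' /derivable_mxP dMij <-] i j|H].
  by rewrite derive_mx// mxE; apply: DeriveDef.
have dM' : derivable M u X by apply/derivable_mxP => i j; have [] := H i j.
apply: DeriveDef => //; rewrite derive_mx//.
by apply/matrixP => i j; rewrite mxE; have [_ ->] := H i j.
Qed.

Lemma is_derive_mulmx m k n (M : V -> 'M[R]_(m, k)) (N : V -> 'M[R]_(k, n))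
    u X dM dN : is_derive u X M dM -> is_derive u X N dN ->
  is_derive u X (fun v => M v *m N v) (dM *m N u + M u *m dN).
Proof.
move=> /is_derive_mxP HM /is_derive_mxP HN; apply/is_derive_mxP => i j.
have -> : (fun v => (M v *m N v) i j)
    = \sum_(l < k) (fun v => M v i l) * (fun v => N v l j).
  by apply/funext => v; rewrite mxE fct_sumE.
apply: is_derive_eq.
rewrite !mxE -big_split/=; apply: eq_bigr => l _.
by rewrite addrC; congr (_ + _); exact: mulrC.
Qed.

Lemma is_derive_trmx m n (M : V -> 'M[R]_(m, n)) u X dM :
  is_derive u X M dM -> is_derive u X (fun v => (M v)^T) dM^T.
Proof.
move=> /is_derive_mxP HM; apply/is_derive_mxP => i j; rewrite mxE.
by under eq_fun do rewrite mxE.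
Qed.

Lemma is_derive_mulmxl m k n (A : 'M[R]_(m, k)) (N : V -> 'M[R]_(k, n)) u X dN :
  is_derive u X N dN -> is_derive u X (fun v => A *m N v) (A *m dN).
Proof.
move=> dN'; have := is_derive_mulmx (is_derive_cst A u X) dN'.
by rewrite mul0mx add0r.
Qed.

(** Both the Euclidean product of R^3 (Gram matrix 1) and the form of R^{4,2}
    are of this shape, so that one product rule serves both. *)
Definition gram k (S : 'M[R]_k) (a b : 'rV[R]_k) : R := (a *m S *m b^T) 0 0.

Lemma is_derive_gram k (S : 'M[R]_k) (a b : V -> 'rV[R]_k) u X da db :
  is_derive u X a da -> is_derive u X b db ->
  is_derive u X (fun v => gram S (a v) (b v))
    (gram S da (b u) + gram S (a u) db).
Proof.
move=> Ha Hb.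
have HaS := is_derive_mulmx Ha (is_derive_cst S u X).
have /is_derive_mxP/(_ 0 0) := is_derive_mulmx HaS (is_derive_trmx Hb).
by rewrite mulmx0 addr0 mxE.
Qed.

Lemma diff_is_derive (W : normedModType R) (g : V -> W) u X :
  differentiable g u -> is_derive u X g ('d g u X).
Proof.
by move=> dg; apply: DeriveDef; [exact: diff_derivable|exact: deriveE].
Qed.

Lemma diff_entry m n (g : V -> 'M[R]_(m, n)) u i j :
  differentiable g u ->
  differentiable (fun v => g v i j) u /\
  forall X, 'd (fun v => g v i j) u X = 'd g u X i j.
Proof.
move=> dg; have dgij : differentiable (fun v => g v i j) u.
  apply: (@differentiable_comp _ _ _ _ g (fun M : 'M[R]_(m, n) => M i j)) => //.
  exact: differentiable_coord.
split=> // X; have /is_derive_mxP/(_ i j)[_ <-] := diff_is_derive X dg.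
by rewrite deriveE.
Qed.

End MatrixCalculus.

(** * Closed one-forms *)

Section ClosedForms.
Variable R : realType.
Local Notation pt := 'rV[R]_2.
Implicit Type U : set pt.

(** Closedness d w = 0 in terms of directional derivatives, their existence
    included, so that the product rules for [is_derive] apply to w. *)
Definition curl_free U m n (w : pt -> pt -> 'M[R]_(m, n)) :=
  forall u, U u -> forall X Y, exists D,
    is_derive u X (w^~ Y) D /\ is_derive u Y (w^~ X) D.

Lemma smooth_diff (W : normedModType R) U (g : pt -> W) u :
  smooth U g -> U u -> differentiable g u.
Proof. by move=> /(_ 1%N)[+ _] Uu => /(_ u Uu). Qed.

Lemma smooth_diff2 (W : normedModType R) U (g : pt -> W) X u :
  smooth U g -> U u -> differentiable (fun v => 'd g v X) u.
Proof. by move=> /(_ 2%N)[_ /(_ X)[+ _]] Uu => /(_ u Uu). Qed.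

(** d (d g) = 0, entry by entry from the symmetry of second derivatives. *)
Lemma curl_free_diff U m n (g : pt -> 'M[R]_(m, n)) : open U -> smooth U g ->
  curl_free U (fun u X => 'd g u X).
Proof.
move=> oU sg u Uu X Y.
exists ('d (fun v => 'd g v Y) u X); split.
  by apply: diff_is_derive; exact: smooth_diff2 Uu.
apply: is_derive_eq; first exact: diff_is_derive Y (smooth_diff2 X sg Uu).
apply/matrixP => i j.
have nU : \forall v \near u, U v by exact: open_nbhs_nbhs.
have gij Z : \forall v \near u, is_derive v Z (fun v => g v i j) ('d g v Z i j).
  apply: filterS nU => v Uv; have dg := smooth_diff sg Uv.
  exact: (is_derive_mxP _ _ _ _).1 (diff_is_derive Z dg) i j.
have dd Z := diff_entry i j (smooth_diff2 Z sg Uu).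
have := second_derivative_symmetric (gij X) (dd X).1 (gij Y) (dd Y).1.
by rewrite (dd X).2 (dd Y).2.
Qed.

Lemma curl_free_closed U m n (eta : pt -> {linear pt -> 'M[R]_(m, n)}) :
  smooth_form U eta -> closed_form U eta -> curl_free U eta.
Proof.
move=> se ce u Uu X Y; exists ('d (eta^~ Y) u X); split.
  by apply: diff_is_derive; exact: smooth_diff (se Y) Uu.
have /eqP := ce u Uu X Y; rewrite /ext_deriv subr_eq0 => /eqP ->.
by apply: diff_is_derive; exact: smooth_diff (se X) Uu.
Qed.

Lemma curl_freeB U m n (w w' : pt -> pt -> 'M[R]_(m, n)) :
  curl_free U w -> curl_free U w' -> curl_free U (fun u X => w u X - w' u X).
Proof.
move=> cw cw' u Uu X Y; have [D [D1 D2]] := cw u Uu X Y.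
have [D' [D1' D2']] := cw' u Uu X Y; exists (D - D').
by split; exact: is_deriveB.
Qed.

Lemma curl_free_mulmxl U m k n (A : 'M[R]_(k, m)) (w : pt -> pt -> 'M[R]_(m, n)) :
  curl_free U w -> curl_free U (fun u X => A *m w u X).
Proof.
move=> cw u Uu X Y; have [D [D1 D2]] := cw u Uu X Y.
by exists (A *m D); split; exact: is_derive_mulmxl.
Qed.

Lemma eq_curl_free U m n (w w' : pt -> pt -> 'M[R]_(m, n)) : open U ->
  (forall u, U u -> forall X, w u X = w' u X) ->
  curl_free U w -> curl_free U w'.
Proof.
move=> oU ww' cw u Uu X Y; have [D [D1 D2]] := cw u Uu X Y.
have nU : \forall v \near u, U v by exact: open_nbhs_nbhs.
exists D; split; [apply: near_eq_is_derive D1|apply: near_eq_is_derive D2];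
  by apply: filterS nU => v /ww' ->.
Qed.

(** Exterior differentiation of (w, h) = 0: since d w = 0, what remains is the
    antisymmetrization of (w X, dh Y).  The symmetry of the second
    fundamental form is the case w = dx, h = n. *)
Lemma curl_free_orthogonal U k (S : 'M[R]_k) (w : pt -> pt -> 'rV[R]_k)
    (h : pt -> 'rV[R]_k) (dh : pt -> pt -> 'rV[R]_k) :
  open U -> curl_free U w ->
  (forall u, U u -> forall X, is_derive u X h (dh u X)) ->
  (forall u, U u -> forall X, gram S (w u X) (h u) = 0) ->
  forall u, U u -> forall X Y,
    gram S (w u X) (dh u Y) = gram S (w u Y) (dh u X).
Proof.
move=> oU cw hh wh u Uu X Y; have [D [D1 D2]] := cw u Uu X Y.
have H Z Z' : is_derive u Z (w^~ Z') D ->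
    gram S D (h u) + gram S (w u Z') (dh u Z) = 0.
  move=> Hw; have [_ <-] := is_derive_gram S Hw (hh u Uu Z).
  rewrite -(derive_cst (0 : R) u Z); apply: near_eq_derive.
  have nU : \forall v \near u, U v by exact: open_nbhs_nbhs.
  by apply: filterS nU => v /wh ->.
by apply: (@addrI _ (gram S D (h u))); rewrite (H Y X D2) (H X Y D1).
Qed.

Lemma is_derive_wedge (G : 'M[R]_6) (a b : pt -> 'rV[R]_6) u X da db :
  is_derive u X a da -> is_derive u X b db ->
  is_derive u X (fun v => wedge G (a v) (b v)) (wedge G da (b u) + wedge G (a u) db).
Proof.
move=> Ha Hb.
have Hab := is_derive_mulmx (is_derive_mulmxl G (is_derive_trmx Ha)) Hb.
have Hba := is_derive_mulmx (is_derive_mulmxl G (is_derive_trmx Hb)) Ha.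
apply: is_derive_eq (is_deriveB Hab Hba) _.
by rewrite /wedge [X in _ - X]addrC opprD addrACA.
Qed.

(** Exterior differentiation of eta = f /\ w + t /\ z when all of eta, w, z
    are closed: df /\ w + dt /\ z has vanishing antisymmetrization. *)
Lemma curl_free_wedge U (G : 'M[R]_6) (f t : pt -> 'rV[R]_6)
    (df dt w z : pt -> pt -> 'rV[R]_6) (eta : pt -> pt -> 'M[R]_6) :
  open U ->
  (forall u, U u -> forall X, is_derive u X f (df u X)) ->
  (forall u, U u -> forall X, is_derive u X t (dt u X)) ->
  curl_free U w -> curl_free U z -> curl_free U eta ->
  (forall u, U u -> forall X,
     eta u X = wedge G (f u) (w u X) + wedge G (t u) (z u X)) ->
  forall u, U u -> forall X Y,
    wedge G (df u X) (w u Y) + wedge G (dt u X) (z u Y) =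
    wedge G (df u Y) (w u X) + wedge G (dt u Y) (z u X).
Proof.
move=> oU hf ht cw cz ce etaE u Uu X Y.
have [D [D1 D2]] := ce u Uu X Y.
have [W [W1 W2]] := cw u Uu X Y.
have [Z [Z1 Z2]] := cz u Uu X Y.
have H X' Y' : is_derive u X' (eta^~ Y') D -> is_derive u X' (w^~ Y') W ->
    is_derive u X' (z^~ Y') Z ->
    D = (wedge G (df u X') (w u Y') + wedge G (f u) W)
       + (wedge G (dt u X') (z u Y') + wedge G (t u) Z).
  move=> [_ <-] Ww Zz.
  have [_ <-] := is_deriveD (is_derive_wedge G (hf u Uu X') Ww)
                            (is_derive_wedge G (ht u Uu X') Zz).
  apply: near_eq_derive.
  have nU : \forall v \near u, U v by exact: open_nbhs_nbhs.
  by apply: filterS nU => v /etaE ->.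
apply: (@addIr _ (wedge G (f u) W + wedge G (t u) Z)).
by rewrite addrACA -(H X Y D1 W1 Z1) (H Y X D2 W2 Z2) addrACA.
Qed.

End ClosedForms.

(** * Bilinear forms *)

Section Gram.
Variables (R : realType) (k : nat) (S : 'M[R]_k).
Implicit Types a b c : 'rV[R]_k.

Lemma gramDl a b c : gram S (a + b) c = gram S a c + gram S b c.
Proof. by rewrite /gram !mulmxDl mxE. Qed.

Lemma gramDr a b c : gram S a (b + c) = gram S a b + gram S a c.
Proof. by rewrite /gram linearD mulmxDr mxE. Qed.

Lemma gramZl (x : R) a b : gram S (x *: a) b = x * gram S a b.
Proof. by rewrite /gram -!scalemxAl mxE. Qed.

Lemma gramZr (x : R) a b : gram S a (x *: b) = x * gram S a b.
Proof. by rewrite /gram linearZ /= -scalemxAr mxE. Qed.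

Lemma gramNl a b : gram S (- a) b = - gram S a b.
Proof. by rewrite -scaleN1r gramZl mulN1r. Qed.

Lemma gramNr a b : gram S a (- b) = - gram S a b.
Proof. by rewrite -scaleN1r gramZr mulN1r. Qed.

Lemma gramC a b : S^T = S -> gram S a b = gram S b a.
Proof.
move=> St; rewrite /gram.
have -> : b *m S *m a^T = (a *m S *m b^T)^T by rewrite !trmx_mul trmxK St mulmxA.
by rewrite [RHS]mxE.
Qed.

End Gram.

Section Dot.
Variable R : realType.
Implicit Types a b c : 'rV[R]_3.

Lemma dotE a b : dot a b = gram 1%:M a b.
Proof. by rewrite /gram mulmx1. Qed.

Lemma dotC a b : dot a b = dot b a.
Proof. by rewrite !dotE gramC// tr_scalar_mx. Qed.

Lemma dotDl a b c : dot (a + b) c = dot a c + dot b c.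
Proof. by rewrite !dotE gramDl. Qed.

Lemma dotZl (x : R) a b : dot (x *: a) b = x * dot a b.
Proof. by rewrite !dotE gramZl. Qed.

Lemma dotZr (x : R) a b : dot a (x *: b) = x * dot a b.
Proof. by rewrite !dotE gramZr. Qed.

Lemma dotNl a b : dot (- a) b = - dot a b.
Proof. by rewrite !dotE gramNl. Qed.

Lemma dotNr a b : dot a (- b) = - dot a b.
Proof. by rewrite !dotE gramNr. Qed.

Lemma dot_eq0 a : (dot a a == 0) = (a == 0).
Proof.
apply/idP/eqP => [|->]; last by rewrite /dot mul0mx mxE.
rewrite /dot mxE psumr_eq0 => [/allP H|i _]; last by rewrite mxE -expr2 sqr_ge0.
apply/rowP => i; have := H i (mem_index_enum i).
by rewrite !mxE /= -expr2 sqrf_eq0 => /eqP.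
Qed.

Lemma is_derive_dot (V : normedModType R) (a b : V -> 'rV[R]_3) u X da db :
  is_derive u X a da -> is_derive u X b db ->
  is_derive u X (fun v => dot (a v) (b v)) (dot da (b u) + dot (a u) db).
Proof.
move=> Ha Hb; rewrite !dotE.
by under eq_fun do rewrite dotE; exact: is_derive_gram.
Qed.

Lemma is_derive_scalel (V : normedModType R) m n (s : V -> R) (q : 'M[R]_(m, n)) u X ds :
  is_derive u X s ds -> is_derive u X (fun v => s v *: q) (ds *: q).
Proof.
move=> Hs; apply/is_derive_mxP => i j.
under eq_fun do rewrite mxE.
have Hq := is_derive_cst (q i j) u X.
apply: is_derive_eq (@is_deriveM _ _ s (cst (q i j)) u X ds 0 Hs Hq) _.
by rewrite scaler0 add0r mxE; exact: mulrC.
Qed.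

Lemma differentiable_dot (V : normedModType R) (a b : V -> 'rV[R]_3) u :
  differentiable a u -> differentiable b u ->
  differentiable (fun v => dot (a v) (b v)) u.
Proof.
move=> da db.
have -> : (fun v => dot (a v) (b v))
    = \sum_(i < 3) (fun v => a v 0 i) * (fun v => b v 0 i).
  by apply/funext => v; rewrite /dot mxE fct_sumE; apply: eq_bigr => i _; rewrite mxE.
apply: differentiable_sum => i; apply: differentiableM.
  exact: (diff_entry 0 i da).1.
exact: (diff_entry 0 i db).1.
Qed.

Lemma differentiable_linear (V : normedModType R) m k
    (L : {linear 'rV[R]_m -> 'rV[R]_k}) (a : V -> 'rV[R]_m) u :
  differentiable a u -> differentiable (fun v => L (a v)) u.
Proof.
move=> da.
have -> : (fun v => L (a v)) = \sum_(i < m) (fun v => a v 0 i *: L (delta_mx 0 i)).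
  apply/funext => v; rewrite {1}(row_sum_delta (a v)) linear_sum fct_sumE.
  by apply: eq_bigr => i _; rewrite linearZ.
apply: differentiable_sum => i; apply: differentiableZl.
exact: (diff_entry 0 i da).1.
Qed.

End Dot.

(** * Differentiating the Lie sphere lift *)

Section LieSphereFrame.
Variable R : realType.
Local Notation pt := 'rV[R]_2.
Variables (G : 'M[R]_6) (p qinf q0 : 'rV[R]_6) (iota : {linear 'rV[R]_3 -> 'rV[R]_6}).
Hypotheses (Gsym : G^T = G) (hframe : frame G p qinf q0 iota).

Lemma mul_wedge (c a b : 'rV[R]_6) :
  c *m wedge G a b = form G c a *: b - form G c b *: a.
Proof.
rewrite /wedge mulmxBr !mulmxA [c *m G *m a^T]mx11_scalar.
by rewrite [c *m G *m b^T]mx11_scalar !mul_scalar_mx.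
Qed.

Lemma form_wedge (c a b e : 'rV[R]_6) :
  form G (c *m wedge G a b) e
  = form G c a * form G b e - form G c b * form G a e.
Proof. by rewrite mul_wedge /form -!/(gram _ _ _) gramDl gramNl !gramZl. Qed.

Definition frame_vec (v : 'rV[R]_3) (a b c : R) : 'rV[R]_6 :=
  iota v + a *: qinf + b *: q0 + c *: p.

Lemma form_frame_vec v a b c v' a' b' c' :
  form G (frame_vec v a b c) (frame_vec v' a' b' c')
  = dot v v' - a * b' - b * a' - c * c'.
Proof.
have [pp [ii oo] [ip op] oi [iotaV iotaP]] := hframe.
have iota0 w : [/\ form G (iota w) qinf = 0, form G (iota w) p = 0
    & form G (iota w) q0 = 0] by apply/iotaP; exists w.
have [vi vp vo] := iota0 v; have [v'i v'p v'o] := iota0 v'.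
rewrite -(iotaV v v') /frame_vec.
have sym a1 b1 : form G a1 b1 = form G b1 a1 by exact: gramC.
have Dl a1 b1 c1 : form G (a1 + b1) c1 = form G a1 c1 + form G b1 c1 by exact: gramDl.
have Dr a1 b1 c1 : form G a1 (b1 + c1) = form G a1 b1 + form G a1 c1 by exact: gramDr.
have Zl (x : R) a1 b1 : form G (x *: a1) b1 = x * form G a1 b1 by exact: gramZl.
have Zr (x : R) a1 b1 : form G a1 (x *: b1) = x * form G a1 b1 by exact: gramZr.
rewrite !(Dl, Dr, Zl, Zr) (sym qinf (iota _)) (sym q0 (iota _)) (sym p (iota _)).
rewrite (sym p qinf) (sym p q0) (sym qinf q0).
by rewrite vi vp vo v'i v'p v'o pp ii oo ip op oi; ring.
Qed.

Lemma form_qinf v a b c : form G qinf (frame_vec v a b c) = - b.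
Proof.
have {1}-> : qinf = frame_vec 0 1 0 0.
  by rewrite /frame_vec linear0 scale1r !scale0r !addr0 add0r.
by rewrite form_frame_vec /dot mul0mx mxE; ring.
Qed.

Lemma form_p v a b c : form G p (frame_vec v a b c) = - c.
Proof.
have {1}-> : p = frame_vec 0 0 0 1.
  by rewrite /frame_vec linear0 scale1r !scale0r !addr0 add0r.
by rewrite form_frame_vec /dot mul0mx mxE; ring.
Qed.

Variables (U : set pt) (x n : pt -> 'rV[R]_3).
Hypotheses (oU : open U) (sx : smooth U x) (hn : gauss_map U x n).

Lemma lift_f_frame u :
  lift_f qinf q0 iota x u = frame_vec (x u) (2^-1 * dot (x u) (x u)) 1 0.
Proof. by rewrite /lift_f /frame_vec scale1r scale0r addr0 addrAC. Qed.

Lemma lift_t_frame u :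
  lift_t p qinf iota x n u = frame_vec (n u) (dot (n u) (x u)) 0 1.
Proof. by rewrite /lift_t /frame_vec scale1r scale0r addr0. Qed.

(** The differentials of the two lifts; in that of t the term (n, dx) is dropped,
    as n is normal to x. *)
Definition dlift_f u X := frame_vec ('d x u X) (dot (x u) ('d x u X)) 0 0.
Definition dlift_t u X := frame_vec ('d n u X) (dot ('d n u X) (x u)) 0 0.

Lemma is_derive_frame (v : pt -> 'rV[R]_3) (a : pt -> R) (b c : R) u X dv da :
  is_derive u X v dv -> is_derive u X a da ->
  is_derive u X (fun w => frame_vec (v w) (a w) b c) (frame_vec dv da 0 0).
Proof.
move=> Hv Ha; rewrite /frame_vec.
have Hi : is_derive u X (fun w => iota (v w)) (iota dv).
  under eq_fun do rewrite -mul_rV_lin1; rewrite -[iota dv]mul_rV_lin1.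
  have := is_derive_mulmx Hv (is_derive_cst (lin1_mx iota) u X).
  by rewrite mulmx0 addr0.
rewrite !scale0r.
have Hb := is_derive_cst (b *: q0) u X; have Hc := is_derive_cst (c *: p) u X.
exact: is_deriveD (is_deriveD (is_deriveD Hi (is_derive_scalel qinf Ha)) Hb) Hc.
Qed.

Lemma is_derive_lift_f u X : U u ->
  is_derive u X (lift_f qinf q0 iota x) (dlift_f u X).
Proof.
move=> Uu; have Hx := diff_is_derive X (smooth_diff sx Uu).
rewrite (funext lift_f_frame).
apply: is_derive_frame => //.
apply: is_derive_eq; first exact: is_deriveZ (is_derive_dot Hx Hx).
by rewrite [dot ('d _ _ _) _]dotC -[_ *: _]/(_ * _); field.
Qed.

Lemma is_derive_lift_t u X : U u ->
  is_derive u X (lift_t p qinf iota x n) (dlift_t u X).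
Proof.
move=> Uu; have Hx := diff_is_derive X (smooth_diff sx Uu).
have [sn /(_ u Uu)[_ nx]] := hn.
have Hn := diff_is_derive X (smooth_diff sn Uu).
rewrite (funext lift_t_frame).
apply: is_derive_frame => //.
by apply: is_derive_eq; [exact: is_derive_dot Hn Hx|rewrite nx addr0].
Qed.

Lemma dot_n_dn u X : U u -> dot (n u) ('d n u X) = 0.
Proof.
move=> Uu; have [sn nn] := hn.
have Hn := diff_is_derive X (smooth_diff sn Uu).
have [_] := is_derive_dot Hn Hn.
rewrite [dot ('d n u X) _]dotC -mulr2n => E; apply/eqP.
have : dot (n u) ('d n u X) *+ 2 == 0.
  rewrite -E -(derive_cst (1 : R) u X); apply/eqP; apply: near_eq_derive.
  have nU : \forall v \near u, U v by exact: open_nbhs_nbhs.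
  by apply: filterS nU => v /nn[->].
by rewrite mulrn_eq0.
Qed.

Lemma differentiable_frame (v : pt -> 'rV[R]_3) (a : pt -> R) (b c : R) u :
  differentiable v u -> differentiable a u ->
  differentiable (fun w => frame_vec (v w) (a w) b c) u.
Proof.
move=> dv da; rewrite /frame_vec.
have Hi := differentiable_linear iota dv.
have Ha := differentiableZl qinf da.
have Hb := differentiable_cst (b *: q0) u.
have Hc := differentiable_cst (c *: p) u.
exact: differentiableD (differentiableD (differentiableD Hi Ha) Hb) Hc.
Qed.

Lemma diff_lift_f u X : U u -> 'd (lift_f qinf q0 iota x) u X = dlift_f u X.
Proof.
move=> Uu; have dx := smooth_diff sx Uu.
have df : differentiable (lift_f qinf q0 iota x) u.
  rewrite (funext lift_f_frame); apply: differentiable_frame => //.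
  exact: differentiableZ (differentiable_dot dx dx).
by rewrite -(deriveE X df); have [_ ->] := is_derive_lift_f X Uu.
Qed.

Lemma diff_lift_t u X : U u -> 'd (lift_t p qinf iota x n) u X = dlift_t u X.
Proof.
move=> Uu; have dx := smooth_diff sx Uu; have dn := smooth_diff hn.1 Uu.
have dt : differentiable (lift_t p qinf iota x n) u.
  rewrite (funext lift_t_frame); apply: differentiable_frame => //.
  exact: differentiable_dot.
by rewrite -(deriveE X dt); have [_ ->] := is_derive_lift_t X Uu.
Qed.

(** Pairing eta = f /\ df.A + t /\ dt.B with the constant vectors qinf and p
    returns - df.A and - dt.B, so these R^{4,2}-valued forms are closed.  They are
    orthogonal to both f and t, whose fibre is null and of contact type;
    [curl_free_orthogonal] gives the four symmetries, and [curl_free_wedge], paired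
    with tangent vectors Z and Z', gives the last identity. *)
Lemma associate_symmetries (eta : pt -> pt -> 'M[R]_6) (A B : pt -> 'M[R]_2) :
  curl_free U eta ->
  (forall u, U u -> forall X, eta u X =
     wedge G (lift_f qinf q0 iota x u) ('d (lift_f qinf q0 iota x) u (X *m A u))
   + wedge G (lift_t p qinf iota x n u) ('d (lift_t p qinf iota x n) u (X *m B u))) ->
  forall u, U u -> forall X Y,
  [/\ dot ('d x u (X *m A u)) ('d x u Y) = dot ('d x u (Y *m A u)) ('d x u X),
      dot ('d x u (X *m A u)) ('d n u Y) = dot ('d x u (Y *m A u)) ('d n u X),
      dot ('d n u (X *m B u)) ('d x u Y) = dot ('d n u (Y *m B u)) ('d x u X),
      dot ('d n u (X *m B u)) ('d n u Y) = dot ('d n u (Y *m B u)) ('d n u X) &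
      forall Z Z',
        let E (y : pt -> 'rV[R]_3) (C : 'M[R]_2) X Y :=
          dot ('d x u Z) ('d y u X) * dot ('d y u (Y *m C)) ('d x u Z')
        - dot ('d x u Z) ('d y u (Y *m C)) * dot ('d y u X) ('d x u Z') in
        E x (A u) X Y + E n (B u) X Y = E x (A u) Y X + E n (B u) Y X].
Proof.
move=> ceta etaE.
have formE a b : gram G a b = form G a b by [].
have etaE' u : U u -> forall X, eta u X =
     wedge G (lift_f qinf q0 iota x u) (dlift_f u (X *m A u))
   + wedge G (lift_t p qinf iota x n u) (dlift_t u (X *m B u)).
  move=> Uu X; rewrite (etaE _ Uu).
  have Ef := congr1 (wedge G (lift_f qinf q0 iota x u)) (diff_lift_f (X *m A u) Uu).
  have Et := congr1 (wedge G (lift_t p qinf iota x n u)) (diff_lift_t (X *m B u) Uu).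
  exact: (f_equal2 (fun M N : 'M[R]_6 => M + N) Ef Et).
pose w u X := dlift_f u (X *m A u); pose z u X := dlift_t u (X *m B u).
have nx u X : U u -> dot (n u) ('d x u X) = 0 by move=> Uu; exact: (hn.2 u Uu).2.
have nn u : U u -> dot (n u) (n u) = 1 by move=> Uu; exact: (hn.2 u Uu).1.
(* (qinf, f) = -1, while qinf is orthogonal to t, df and dt. *)
have cw : curl_free U w.
  apply: (eq_curl_free oU) (curl_free_mulmxl (- qinf) ceta) => u Uu X.
  rewrite etaE'// mulmxDr !mulNmx !mul_wedge lift_f_frame lift_t_frame /dlift_f /dlift_t.
  rewrite !form_qinf.
  by rewrite !(oppr0, scaleN1r, scale0r, subr0, opprK, addr0).
(* (p, t) = -1, while p is orthogonal to f, df and dt. *)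
have cz : curl_free U z.
  apply: (eq_curl_free oU) (curl_free_mulmxl (- p) ceta) => u Uu X.
  rewrite etaE'// mulmxDr !mulNmx !mul_wedge lift_f_frame lift_t_frame /dlift_f /dlift_t.
  rewrite !form_p.
  by rewrite !(oppr0, scaleN1r, scale0r, subr0, opprK, add0r).
have hf u : U u -> forall X, is_derive u X (lift_f qinf q0 iota x) (dlift_f u X).
  by move=> Uu X; exact: is_derive_lift_f.
have ht u : U u -> forall X, is_derive u X (lift_t p qinf iota x n) (dlift_t u X).
  by move=> Uu X; exact: is_derive_lift_t.
have wf u : U u -> forall X, gram G (w u X) (lift_f qinf q0 iota x u) = 0.
  move=> Uu X; rewrite /w /dlift_f formE lift_f_frame form_frame_vec.
  by rewrite [dot ('d _ _ _) _]dotC; ring.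
have wt u : U u -> forall X, gram G (w u X) (lift_t p qinf iota x n u) = 0.
  move=> Uu X; rewrite /w /dlift_f formE lift_t_frame form_frame_vec.
  by rewrite [dot ('d _ _ _) _]dotC nx//; ring.
have zf u : U u -> forall X, gram G (z u X) (lift_f qinf q0 iota x u) = 0.
  by move=> Uu X; rewrite /z /dlift_t formE lift_f_frame form_frame_vec; ring.
have zt u : U u -> forall X, gram G (z u X) (lift_t p qinf iota x n u) = 0.
  move=> Uu X; rewrite /z /dlift_t formE lift_t_frame form_frame_vec.
  by rewrite [dot ('d _ _ _) (n u)]dotC dot_n_dn//; ring.
have dd v a v' a' : form G (frame_vec v a 0 0) (frame_vec v' a' 0 0) = dot v v'.
  by rewrite form_frame_vec; ring.
move=> u Uu X Y; split.
- have := curl_free_orthogonal oU cw hf wf Uu X Y.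
  by rewrite !formE /w /dlift_f !dd.
- have := curl_free_orthogonal oU cw ht wt Uu X Y.
  by rewrite !formE /w /dlift_f /dlift_t !dd.
- have := curl_free_orthogonal oU cz hf zf Uu X Y.
  by rewrite !formE /z /dlift_f /dlift_t !dd.
- have := curl_free_orthogonal oU cz ht zt Uu X Y.
  by rewrite !formE /z /dlift_t !dd.
move=> Z Z' E.
have D a b c d : form G (dlift_f u Z *m (wedge G a b + wedge G c d)) (dlift_f u Z')
    = (form G (dlift_f u Z) a * form G b (dlift_f u Z')
       - form G (dlift_f u Z) b * form G a (dlift_f u Z'))
    + (form G (dlift_f u Z) c * form G d (dlift_f u Z')
       - form G (dlift_f u Z) d * form G c (dlift_f u Z')).
  by rewrite mulmxDr -!form_wedge; exact: gramDl.
have W := curl_free_wedge oU hf ht cw cz ceta etaE' Uu X Y.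
have := etrans (esym (D _ _ _ _))
  (etrans (congr1 (fun M => form G (dlift_f u Z *m M) (dlift_f u Z')) W) (D _ _ _ _)).
by rewrite /w /z /dlift_f /dlift_t !dd.
Qed.

End LieSphereFrame.

(** * Linear algebra at a point *)

Section PrincipalDirections.
Variable R : realType.
Local Notation pt := 'rV[R]_2.
Local Notation E3 := 'rV[R]_3.

Lemma ord2P (P : 'I_2 -> Prop) : P 0 -> P 1 -> forall j, P j.
Proof.
move=> P0 P1 [[|[|//]] i].
  by rewrite (_ : Ordinal i = 0)//; exact: val_inj.
by rewrite (_ : Ordinal i = 1)//; exact: val_inj.
Qed.

Lemma span2 (e0 e1 : pt) : e0 != 0 -> e1 != 0 ->
  (forall a b : R, a *: e0 = b *: e1 -> a *: e0 = 0) ->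
  forall X, exists a b : R, X = a *: e0 + b *: e1.
Proof.
move=> e0N e1N indep X.
have cap0 : (e0 :&: e1)%MS = 0.
  apply/eqP/rowV0P => v; rewrite sub_capmx => /andP[/sub_rVP[a ->] /sub_rVP[b E]].
  exact: indep E.
have full : row_full (e0 + e1)%MS.
  by rewrite /row_full (mxrank_disjoint_sum cap0) !rank_rV e0N e1N.
have /sub_addsmxP[[c d] /= ->] := submx_full X full.
exists (c 0 0), (d 0 0).
by rewrite [c in LHS]mx11_scalar [d in LHS]mx11_scalar !mul_scalar_mx.
Qed.

Variables (dx dn : {linear pt -> E3}) (k : 'I_2 -> R) (e : 'I_2 -> pt).
Hypotheses (dx_inj : forall X, dx X = 0 -> X = 0)
  (eN0 : forall j, e j != 0)
  (indep : forall a b : R, a *: e 0 = b *: e 1 -> a *: e 0 = 0)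
  (dn_e : forall j, dn (e j) = - k j *: dx (e j))
  (kN0 : forall j, k j != 0) (umb : k 0 != k 1).

Let sq j := dot (dx (e j)) (dx (e j)).

Let sqN0 j : sq j != 0.
Proof. by rewrite /sq dot_eq0; apply: contra_neq (eN0 j); exact: dx_inj. Qed.

(** Symmetry of the second fundamental form, with distinct eigenvalues. *)
Lemma curvature_directions_orthogonal :
  dot (dx (e 0)) (dn (e 1)) = dot (dx (e 1)) (dn (e 0)) ->
  dot (dx (e 0)) (dx (e 1)) = 0.
Proof.
rewrite !dn_e !dotZr [dot (dx (e 1)) _]dotC => /eqP.
rewrite -subr_eq0 -mulrBl mulf_eq0 => /orP[|/eqP //].
by rewrite opprK addrC subr_eq0 (negPf umb).
Qed.

Hypothesis orth : dot (dx (e 0)) (dx (e 1)) = 0.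

(** Off-diagonal entries m01, m10 of M in the basis e satisfy
    m01 l1 |dx e1|^2 = m10 l0 |dx e0|^2 by symmetry against dx, and the same
    relation with k1 on the left and k0 on the right by symmetry against dn.  As
    k0 <> k1 both vanish.  It serves for A with L = dx and for B with L = dn. *)
Lemma preserves_curvature_directions (L : {linear pt -> E3}) (l : 'I_2 -> R)
    (M : 'M[R]_2) :
  (forall j, L (e j) = l j *: dx (e j)) -> (forall j, l j != 0) ->
  (forall X Y, dot (L (X *m M)) (dx Y) = dot (L (Y *m M)) (dx X)) ->
  (forall X Y, dot (L (X *m M)) (dn Y) = dot (L (Y *m M)) (dn X)) ->
  exists a : 'I_2 -> R, forall j, L (e j *m M) = a j *: L (e j).
Proof.
move=> Le lN0 symx symn.
have [a00 [a01 E0]] := span2 (eN0 0) (eN0 1) indep (e 0 *m M).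
have [a10 [a11 E1]] := span2 (eN0 0) (eN0 1) indep (e 1 *m M).
have orth' : dot (dx (e 1)) (dx (e 0)) = 0 by rewrite dotC.
have := symx (e 0) (e 1); have := symn (e 0) (e 1).
rewrite !dn_e !dotZr E0 E1 !linearD /= !linearZ /= !Le !dotDl !dotZl orth orth'.
rewrite !mulr0 add0r addr0 -/(sq 0) -/(sq 1) => Hn Hx.
have a01_0 : a01 = 0.
  have : (k 0 - k 1) * (a01 * (l 1 * sq 1)) = 0.
    by rewrite mulrBl {1}Hx; lra.
  move=> /eqP; rewrite !mulf_eq0 subr_eq0 (negPf umb) (negPf (lN0 1)) (negPf (sqN0 1)).
  by rewrite !orbF => /eqP.
have a10_0 : a10 = 0.
  move: Hx; rewrite a01_0 mul0r => /esym/eqP.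
  by rewrite !mulf_eq0 (negPf (lN0 0)) (negPf (sqN0 0)) !orbF => /eqP.
exists (fun j => if j == 0 then a00 else a11); apply: ord2P => /=.
  by rewrite E0 a01_0 scale0r addr0 linearZ.
by rewrite E1 a10_0 scale0r add0r linearZ.
Qed.

(** On the orthogonal pair dx e0, dx e1 every term of the hypothesis is a multiple
    of |dx e0|^2 |dx e1|^2, and the coefficients add up to the claim. *)
Lemma principal_relation (A B : 'M[R]_2) (a b : 'I_2 -> R) :
  (forall j, dx (e j *m A) = a j *: dx (e j)) ->
  (forall j, dn (e j *m B) = b j *: dn (e j)) ->
  (let E (y : {linear pt -> E3}) (C : 'M[R]_2) X Y :=
     dot (dx (e 0)) (y X) * dot (y (Y *m C)) (dx (e 1))
   - dot (dx (e 0)) (y (Y *m C)) * dot (y X) (dx (e 1)) in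
   E dx A (e 0) (e 1) + E dn B (e 0) (e 1)
   = E dx A (e 1) (e 0) + E dn B (e 1) (e 0)) ->
  a 0 + a 1 + k 0 * k 1 * (b 0 + b 1) = 0.
Proof.
move=> Ea Eb /=; rewrite !Ea !Eb !dn_e !(dotZl, dotZr) orth -/(sq 0) -/(sq 1) => H.
have : (a 0 + a 1 + k 0 * k 1 * (b 0 + b 1)) * (sq 0 * sq 1) = 0 by lra.
by move=> /eqP; rewrite !mulf_eq0 (negPf (sqN0 0)) (negPf (sqN0 1)) !orbF => /eqP.
Qed.

End PrincipalDirections.

(** * Smoothness of the opposite normal *)

Section NearEq.
Variables (R : realType) (V W : normedModType R).

Lemma near_eq_differentiable (f g : V -> W) (a : V) :
  (\forall v \near a, f v = g v) -> differentiable f a ->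
  differentiable g a /\ 'd g a = 'd f a :> (V -> W).
Proof.
move=> fg df.
have [cdf Ef] := (diff_locallyP _ _).1 df.
have Eg : g \o shift a = cst (g a) + 'd f a +o_ (0 : V) id.
  apply/eqaddoP => e e0; have /eqaddoP/(_ e e0) Hf := Ef.
  have shift_a : (shift a) w @[w --> (0 : V)] --> a.
    by rewrite -[X in _ --> X]add0r; apply: cvgD; [exact: cvg_id|exact: cvg_cst].
  near=> w.
  have Ew : f (w + a) = g (w + a) by near: w; exact: shift_a fg.
  have : `|(f \o shift a - (cst (f a) + 'd f a)) w| <= e * `|id w|.
    by near: w; exact: Hf.
  by rewrite !fctE /= Ew (nbhs_singleton fg).
have dgE := diff_unique cdf Eg.
split; last exact: dgE.
by apply/diff_locallyP; split; rewrite dgE; [exact: cdf|exact: Eg].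
Unshelve. all: by end_near. Qed.

End NearEq.

(** Differentials of an opposite are opposite only where the map is differentiable,
    so the induction is about maps that agree with - g on the open set U. *)
Lemma smoothN (R : realType) (W : normedModType R) (U : set 'rV[R]_2)
    (g : 'rV[R]_2 -> W) :
  open U -> smooth U g -> smooth U (fun u => - g u).
Proof.
move=> oU sg k; move: (sg k) => {sg}.
suff H h : (forall u, U u -> h u = - g u) -> Ck_on U k g -> Ck_on U k h by exact: H.
have nU u : U u -> \forall v \near u, U v by move=> Uu; exact: open_nbhs_nbhs.
elim: k g h => [|k IH] g h hg /=.
  move=> cg u Uu.
  have gh : \forall v \near u, - g v = h v by apply: filterS (nU u Uu) => v /hg ->.
  rewrite /prop_for /continuous_at (hg u Uu).
  apply: cvg_trans; first exact: near_eq_cvg gh.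
  by apply: cvgN; exact: cg.
move=> [dg cg].
have dh u : U u -> differentiable h u /\ 'd h u = 'd (- g) u :> (_ -> W).
  move=> Uu; apply: near_eq_differentiable.
    by apply: filterS (nU u Uu) => v /hg ->.
  exact: differentiableN (dg u Uu).
split=> [u /dh[]//|X]; apply: IH (cg X) => u Uu.
by rewrite (dh u Uu).2 diffN//; exact: dg.
Qed.

(** * Principal curvatures of the associate surfaces *)

Lemma parallel_scale (R : realType) (v w z : 'rV[R]_3) (a b : R) :
  v = a *: z -> w = b *: z -> parallel v w.
Proof.
move=> -> ->; rewrite /parallel (_ : col_mx _ _ = col_mx a%:M b%:M *m z).
  by rewrite (leq_trans (mxrankM_maxr _ _))// rank_leq_row.
by rewrite mul_col_mx !mul_scalar_mx.
Qed.

Lemma S_form (R : realType) (a b c d a' b' c' d' : R) :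
  row4 a b c d *m S_matrix R *m (row4 a' b' c' d')^T
  = (a * b' + b * a' + c * d' + d * c')%:M.
Proof.
apply/matrixP => i j; rewrite !ord1 !mxE !big_ord_recl big_ord0 !mxE /=.
rewrite !big_ord_recl !big_ord0 !mxE /=; ring.
Qed.

(** On T_j the differential of xD is a_j dx and that of xh is b_j dn, where a_j and
    b_j are the eigenvalues of A and B; the relation between them is the O-surface
    condition multiplied by - kappa_0 kappa_1. *)
Lemma associate_principal (R : realType)
  (G : 'M[R]_6) (p qinf q0 : 'rV[R]_6) (iota : {linear 'rV[R]_3 -> 'rV[R]_6})
  (U : set 'rV[R]_2) (x n xD xh : 'rV[R]_2 -> 'rV[R]_3)
  (T : 'I_2 -> 'rV[R]_2 -> set 'rV[R]_2) (kappa : 'I_2 -> 'rV[R]_2 -> R)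
  (Gsym : G^T = G) (hframe : frame G p qinf q0 iota)
  (hU : open U) (hx : immersion U x) (hn : gauss_map U x n)
  (hT : curvature_subbundles U x n T kappa)
  (hkappa : forall j u, U u -> kappa j u != 0)
  (humb : umbilic_free U kappa)
  (hassoc : associate G p qinf q0 iota U x n xD xh) u : U u ->
  exists a b : 'I_2 -> R,
    (forall j X, T j u X ->
       'd xD u X = a j *: 'd x u X /\ 'd xh u X = b j *: 'd n u X) /\
    a 0 + a 1 + kappa 0 u * kappa 1 u * (b 0 + b 1) = 0.
Proof.
move=> Uu.
have [eta [tau [A [B [[[seta ceta] _ _ _] [stau _] _ [_ _ etaE] [_ _ xDh]]]]]] := hassoc.
have [sx dx_inj] := hx.
have cf := curl_freeB (curl_free_closed seta ceta) (curl_free_diff hU stau).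
have sym := associate_symmetries Gsym hframe hU sx hn cf etaE Uu.
have [[hline hsplit] hk] := hT.
have /choice[e he] : forall j, exists ej : 'rV[R]_2, ej != 0 /\
    T j u = [set X | exists c : R, X = c *: ej].
  move=> j; have [V [e [_ Vu _ _ /(_ u Vu)[e0 TE]]]] := hline j u Uu.
  by exists (e u).
have Te j : T j u (e j) by rewrite (he j).2; exists 1; rewrite scale1r.
have eN0 j : e j != 0 := (he j).1.
have indep (a b : R) : a *: e 0 = b *: e 1 -> a *: e 0 = 0.
  move=> E; have : (T 0 u `&` T 1 u) (a *: e 0).
    by rewrite (he 0).2 (he 1).2; split; [exists a|exists b].
  by rewrite hsplit.
have dn_e j : 'd n u (e j) = - kappa j u *: 'd x u (e j).
  apply/eqP; rewrite scaleNr -addr_eq0; apply/eqP.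
  exact: (hk j).2 u Uu _ (Te j).
have kN0 j : kappa j u != 0 := hkappa j u Uu.
have NkN0 j : - kappa j u != 0 by rewrite oppr_eq0.
have dxN0 := dx_inj u Uu.
have umb := humb u Uu.
have nx v : U v -> forall X, gram 1%:M ('d x v X) (n v) = 0.
  by move=> Uv X; rewrite -dotE dotC; exact: (hn.2 v Uv).2.
have dn v : U v -> forall X, is_derive v X n ('d n v X).
  by move=> Uv X; apply: diff_is_derive; exact: smooth_diff hn.1 Uv.
have orth : dot ('d x u (e 0)) ('d x u (e 1)) = 0.
  apply: (curvature_directions_orthogonal dn_e umb).
  by rewrite !dotE; exact: (curl_free_orthogonal hU (curl_free_diff hU sx) dn nx Uu).
have dx_e j : 'd x u (e j) = (1 : R) *: 'd x u (e j) := esym (scale1r _).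
have N1 (j : 'I_2) : (1 : R) != 0 := oner_neq0 R.
have [a aE] : exists a : 'I_2 -> R,
    forall j, 'd x u (e j *m A u) = a j *: 'd x u (e j).
  apply: (preserves_curvature_directions dxN0 eN0 indep dn_e umb orth (l := fun=> 1) dx_e N1).
  - by move=> X Y; have [H _ _ _ _] := sym X Y; exact: H.
  - by move=> X Y; have [_ H _ _ _] := sym X Y; exact: H.
have [b bE] : exists b : 'I_2 -> R,
    forall j, 'd n u (e j *m B u) = b j *: 'd n u (e j).
  apply: (preserves_curvature_directions dxN0 eN0 indep dn_e umb orth dn_e NkN0).
  - by move=> X Y; have [_ _ H _ _] := sym X Y; exact: H.
  - by move=> X Y; have [_ _ _ H _] := sym X Y; exact: H.
exists a, b; split.
  move=> j X; rewrite (he j).2 => -[c ->]; have [ED Eh] := xDh u Uu (c *: e j).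
  have onL (L : {linear 'rV[R]_2 -> 'rV[R]_3}) M (r : R) :
      L (e j *m M) = r *: L (e j) -> L (c *: e j *m M) = r *: L (c *: e j).
    by move=> E; rewrite -scalemxAl !linearZ /= E !scalerA mulrC.
  by split; [exact: etrans ED (onL _ _ _ (aE j))|exact: etrans Eh (onL _ _ _ (bE j))].
apply: (principal_relation dxN0 eN0 dn_e orth aE bE).
by have [_ _ _ _ H] := sym (e 0) (e 1); exact: H.
Qed.

(** * Associate surfaces form a system of O-surfaces *)

Theorem mainTheorem3 (R : realType)
  (G : 'M[R]_6) (p qinf q0 : 'rV[R]_6) (iota : {linear 'rV[R]_3 -> 'rV[R]_6})
  (U : set 'rV[R]_2) (x n xD xh : 'rV[R]_2 -> 'rV[R]_3)
  (T : 'I_2 -> 'rV[R]_2 -> set 'rV[R]_2) (kappa : 'I_2 -> 'rV[R]_2 -> R)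
  (hG : signature42 G) (hframe : frame G p qinf q0 iota)
  (hU : open U) (hx : immersion U x) (hn : gauss_map U x n)
  (hT : curvature_subbundles U x n T kappa)
  (hkappa : forall j u, U u -> kappa j u != 0)
  (humb : umbilic_free U kappa)
  (hOmega : Omega_surface G p qinf q0 iota U x n)
  (hassoc : associate G p qinf q0 iota U x n xD xh) :
  exists rD rh : 'I_2 -> 'rV[R]_2 -> R,
    O_system U T
      (fun i : 'I_4 => tnth [tuple x; xD; xh; n] i)
      (fun i : 'I_4 =>
         tnth [tuple n; (fun u => - n u); (fun u => - n u); n] i)
      (fun j u => row4 (kappa j u)^-1 (rD j u) (rh j u) (-1))
      (S_matrix R).
Proof.
have [Gsym _] := hG; have [sx dx_inj] := hx; have [sn nP] := hn.
have [split_T hk] := hT.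
have [_ [_ [A [B [_ _ _ _ [sD sh xDh]]]]]] := hassoc.
have /choice[ab abP] : forall u, exists ab : ('I_2 -> R) * ('I_2 -> R), U u ->
    (forall j X, T j u X ->
       'd xD u X = ab.1 j *: 'd x u X /\ 'd xh u X = ab.2 j *: 'd n u X) /\
    ab.1 0 + ab.1 1 + kappa 0 u * kappa 1 u * (ab.2 0 + ab.2 1) = 0.
  move=> u; have [Uu|nUu] := pselect (U u); last by exists (fun=> 0, fun=> 0) => /nUu.
  have [a [b ?]] :=
    associate_principal Gsym hframe hU hx hn hT hkappa humb hassoc Uu.
  by exists (a, b).
(* On T_j one has dx = - dn / kappa_j, so dxD = a_j dx = - (a_j / kappa_j) dn. *)
exists (fun j u => - (ab u).1 j / kappa j u), (fun j u => (ab u).2 j).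
have dnE j u X : U u -> T j u X -> 'd n u X = - kappa j u *: 'd x u X.
  move=> Uu TX; apply/eqP; rewrite scaleNr -addr_eq0; apply/eqP.
  exact: (hk j).2 u Uu X TX.
have dNn u X : U u -> 'd (fun v => - n v) u X = - 'd n u X.
  by move=> Uu; exact: (congr1 (fun L => L X) (diffN (smooth_diff sn Uu))).
have gauss_N y : (forall u, U u -> forall X, dot (n u) ('d y u X) = 0) ->
    gauss_map U y (fun u => - n u).
  move=> ny; split=> [|u Uu]; first exact: smoothN.
  split=> [|X]; first by rewrite dotNl dotNr opprK; exact: (nP u Uu).1.
  by rewrite dotNl ny// oppr0.
have recip_x (v w : 'rV[R]_3) (k : R) : k != 0 -> w = - k *: v -> v + k^-1 *: w = 0.
  by move=> k0 ->; rewrite scalerA mulrN mulVf// scaleN1r subrr.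
have recip_D (v w w' z : 'rV[R]_3) (k a : R) : k != 0 -> w = - k *: v ->
    w' = - w -> z = a *: v -> z + (- a / k) *: w' = 0.
  move=> k0 -> -> ->.
  by rewrite -scaleNr opprK scalerA divfK// -scalerDl subrr scale0r.
have recip_h (w w' z : 'rV[R]_3) (b : R) : w' = - w -> z = b *: w -> z + b *: w' = 0.
  by move=> -> ->; rewrite scalerN subrr.
have recip_n (w : 'rV[R]_3) : w + (-1) *: w = 0 by rewrite scaleN1r subrr.
split.
- apply/matrixP => i j; rewrite !mxE.
  by case: i => [[|[|[|[|//]]]] ?]; case: j => [[|[|[|[|//]]]] ?].
- have gD : gauss_map U xD (fun u => - n u).
    apply: gauss_N => u Uu X; have [ED _] := xDh u Uu X.
    have E := congr1 (dot (n u)) ED.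
    have nx := (nP u Uu).2 (X *m A u).
    have E' := etrans E nx.
    exact: E'.
  have gh : gauss_map U xh (fun u => - n u).
    apply: gauss_N => u Uu X; have [_ Eh] := xDh u Uu X.
    have E := congr1 (dot (n u)) Eh.
    exact: etrans E (dot_n_dn hU hn (X *m B u) Uu).
  have gn : gauss_map U n n.
    split; first exact: sn.
    move=> u Uu; split; first exact: (nP u Uu).1.
    by move=> X; exact: (dot_n_dn hU hn X Uu).
  case=> [[|[|[|[|//]]]] ?].
  + exact: conj sx hn.
  + exact: conj sD gD.
  + exact: conj sh gh.
  + exact: conj sn gn.
- split; first exact: split_T.
  move=> i l j u Uu X TX.
  have mult (m : 'I_4) : exists c : R,
      'd (tnth [tuple x; xD; xh; n] m) u X = c *: 'd x u X.
    have [ED Eh] := (abP u Uu).1 j X TX.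
    have En := dnE j u X Uu TX.
    case: m => [[|[|[|[|//]]]] ?].
    + by exists 1; exact: esym (scale1r _).
    + by exists ((ab u).1 j); exact: ED.
    + exists ((ab u).2 j * - kappa j u); apply: etrans Eh _.
      exact: etrans (congr1 _ En) (scalerA _ _ _).
    + by exists (- kappa j u); exact: En.
  have [c Ec] := mult i; have [c' Ec'] := mult l.
  exact: parallel_scale Ec Ec'.
- have row4E a b c d (i : 'I_4) : row4 a b c d 0 i = [:: a; b; c; d]`_i :> R.
    by rewrite mxE.
  move=> i j u Uu; rewrite row4E => X TX XN0.
  have kN0 := hkappa j u Uu.
  have En := dnE j u X Uu TX; have EN := dNn u X Uu.
  have [ED Eh] := (abP u Uu).1 j X TX.
  have dnN0 : 'd n u X != 0.
    apply: contra_neq XN0 => dn0; apply: (dx_inj u Uu).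
    apply/eqP; move/eqP: (etrans (esym En) dn0).
    by rewrite scaler_eq0 oppr_eq0 (negPf kN0).
  have dNnN0 : 'd (fun v => - n v) u X != 0.
    by apply: contra_neq dnN0 => /(etrans (esym EN))/eqP; rewrite oppr_eq0 => /eqP.
  case: i => [[|[|[|[|//]]]] ?].
  + have Ex := recip_x _ _ _ kN0 En; exact (conj dnN0 Ex).
  + have ExD := recip_D _ _ _ _ _ _ kN0 En EN ED; exact (conj dNnN0 ExD).
  + have Exh := recip_h _ _ _ _ EN Eh; exact (conj dNnN0 Exh).
  + exact (conj dnN0 (recip_n ('d n u X))).
- move=> u Uu; rewrite S_form.
  have [_ rel] := abP u Uu.
  have k0 := hkappa 0 u Uu; have k1 := hkappa 1 u Uu.
  move: (ab u) rel => [a b] /= rel.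
  have -> : (kappa 0 u)^-1 * (- a 1 / kappa 1 u) + - a 0 / kappa 0 u * (kappa 1 u)^-1
      + b 0 * -1 + -1 * b 1
      = - (a 0 + a 1 + kappa 0 u * kappa 1 u * (b 0 + b 1)) / (kappa 0 u * kappa 1 u).
    by field; rewrite k0 k1.
  by rewrite rel oppr0 mul0r raddf0.
Qed.
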